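(* For each integer $i\geq 0$ let $\mathcal{S}_i$ be the set of all numerical semigroups admitting the pattern $x_1+\cdots+x_i-x_{i+1}$ (for $i=0$ this is the pattern $-x_1$). Then $\mathcal{S}_0=\emptyset$, $\mathcal{S}_1=\{\mathbb{N}\}$, $\mathcal{S}_2$ is the set of all Arf numerical semigroups, $\mathcal{S}_i\subseteq\mathcal{S}_{i+1}$ for all $i\geq 0$, every numerical semigroup belongs to $\mathcal{S}_i$ for some $i$, and the ascending chain $\mathcal{S}_0\subseteq\mathcal{S}_1\subseteq\mathcal{S}_2\subseteq\cdots$ does not stabilize (i.e., there is no $i_0$ with $\mathcal{S}_i=\mathcal{S}_{i_0}$ for all $i\geq i_0$).
   Context: $\mathbb{N}$ denotes the set of nonnegative integers. A numerical semigroup is a subset of $\mathbb{N}$ that contains $0$, is closed under addition and has finite complement in $\mathbb{N}$. A pattern of length $n$ is a linear homogeneous polynomial $p=\sum_{i=1}^n a_ix_i$ with all $a_i$ non-zero integers. A numerical semigroup $\Lambda$ admits a pattern $p$ of length $n$ if $p(s_1,\dots,s_n)\in\Lambda$ for all $s_1\geq s_2\geq\dots\geq s_n$ in $\Lambda$. A numerical semigroup $\Lambda$ is Arf if for all $x,y,z\in\Lambda$ with $x\geq y\geq z$ one has $x+y-z\in\Lambda$. *)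

(* Defs.v *)
From mathcomp Require Import all_boot all_order all_algebra all_classical.

Set Implicit Arguments.
Unset Strict Implicit.
Unset Printing Implicit Defensive.

Import GRing.Theory.

Local Open Scope classical_set_scope.
Local Open Scope ring_scope.

Definition numerical_semigroup (L : set nat) : Prop :=
  [/\ L 0%N,
      forall x y : nat, L x -> L y -> L (x + y)%N
    & finite_set (~` L)].

(* The linear form \sum_k a_k x_k is given by its coefficient family; the
   variable x_(k+1) has index k : 'I_n. *)
Record pattern (n : nat) : Type := Pattern {
  pattern_coef :> {ffun 'I_n -> int};
  pattern_coef_neq0 : forall k : 'I_n, pattern_coef k != 0
}.

Definition pattern_eval (n : nat) (p : pattern n) (s : 'I_n -> nat) : int :=
  \sum_(k < n) p k * (s k)%:Z.

(* The value of a pattern is an integer, possibly negative: it has to lie in L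
   seen as a subset of int. *)
Definition admits (L : set nat) (n : nat) (p : pattern n) : Prop :=
  forall s : 'I_n -> nat,
    (forall k : 'I_n, L (s k)) ->
    (forall j k : 'I_n, (j <= k)%N -> (s k <= s j)%N) ->
    (Posz @` L) (pattern_eval p s).

(* The subtraction on nat is exact here since z <= x. *)
Definition Arf (L : set nat) : Prop :=
  numerical_semigroup L /\
  forall x y z : nat, L x -> L y -> L z ->
    (y <= x)%N -> (z <= y)%N -> L (x + y - z)%N.

Definition subtraction_coef (i : nat) : {ffun 'I_i.+1 -> int} :=
  [ffun k : 'I_i.+1 => if (k < i)%N then 1 else -1].

Lemma subtraction_coef_neq0 (i : nat) (k : 'I_i.+1) :
  subtraction_coef i k != 0.
Proof. by rewrite ffunE; case: ifP. Qed.

(* x_1 + ... + x_i - x_(i+1) *)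
Definition subtraction_pattern (i : nat) : pattern i.+1 :=
  Pattern (@subtraction_coef_neq0 i).

Definition subtraction_class (i : nat) : set (set nat) :=
  [set L | numerical_semigroup L /\ admits L (subtraction_pattern i)].

(* Main.v *)
Require Import Defs.
From mathcomp Require Import all_boot all_order all_algebra all_classical.
From mathcomp Require Import zify.

Set Implicit Arguments.
Unset Strict Implicit.

Local Open Scope classical_set_scope.

(** A pattern of length [i.+2] is split as the head variable plus a pattern of
    length [i.+1], which gives the inclusions.  If all integers [>= c] lie in
    [L], then [s_1 + ... + s_(c+1) - s_(c+2) >= c] as soon as [s_(c+2) > 0], so
    [L] belongs to the class of index [c+1].  The chain does not stabilize
    because the semigroup generated by [m] and [m+1], whose elements are the
    [q * m + r] with [r <= q], does not contain
    [i * (m + 1) - m = (i - 1) * m + i] when [i < m]. *)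

Lemma pattern_eval_subtraction (i : nat) (s : 'I_i.+1 -> nat) :
  pattern_eval (subtraction_pattern i) s =
  (Posz (\sum_(k < i) s (widen_ord (leqnSn i) k))%N - Posz (s ord_max))%R.
Proof.
rewrite /pattern_eval big_ord_recr /= ffunE /= ltnn GRing.mulN1r; congr (_ - _)%R.
rewrite (big_morph Posz PoszD (erefl _)); apply: eq_bigr => k _.
by rewrite ffunE /= ltn_ord GRing.mul1r.
Qed.

(** The factor [i.+1] is what the exhaustiveness argument uses; the factor 1 is enough for truncated
    subtraction to be exact. *)
Lemma leq_last_sum (i : nat) (s : 'I_i.+2 -> nat) :
  (forall j k : 'I_i.+2, (j <= k)%N -> (s k <= s j)%N) ->
  ((i.+1 * s ord_max)%N <= \sum_(k < i.+1) s (widen_ord (leqnSn i.+1) k))%N.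
Proof.
move=> sdec; rewrite -{1}(card_ord i.+1) -sum_nat_const.
by apply: leq_sum => k _; apply: sdec; rewrite /= ltnW.
Qed.

(** With at least one positive term, the sum dominates the last variable, so the integer value is
    nonnegative and subtraction in [nat] computes it. *)
Lemma admits_subtractionSP (L : set nat) (i : nat) :
  admits L (subtraction_pattern i.+1) <->
  forall s : 'I_i.+2 -> nat, (forall k, L (s k)) ->
    (forall j k : 'I_i.+2, (j <= k)%N -> (s k <= s j)%N) ->
    L (\sum_(k < i.+1) s (widen_ord (leqnSn i.+1) k) - s ord_max)%N.
Proof.
have le_last s (sdec : forall j k : 'I_i.+2, (j <= k)%N -> (s k <= s j)%N) :
  (s ord_max <= \sum_(k < i.+1) s (widen_ord (leqnSn i.+1) k))%N.
  by apply: leq_trans (leq_last_sum sdec); rewrite leq_pmull.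
split=> Lp s sL sdec; have := Lp s sL sdec; have := le_last s sdec.
  rewrite pattern_eval_subtraction => le_s [x Lx xE].
  by rewrite (_ : (_ - _)%N = x)//; lia.
move=> le_s Ls; rewrite pattern_eval_subtraction.
by eexists; [exact: Ls | lia].
Qed.

Lemma numerical_semigroup_conductor (L : set nat) :
  numerical_semigroup L -> exists c, forall n, (c <= n)%N -> L n.
Proof.
move=> [_ _ /finite_seqP[s sE]]; exists (\max_(x <- s) x).+1 => n lt_n.
apply: contrapT => nLn; have : [set` s] n by rewrite -sE.
move=> /= ns; suff: (n <= \max_(x <- s) x)%N by rewrite leqNgt lt_n.
exact: (@leq_bigmax_seq _ s predT id).
Qed.

Lemma numerical_semigroup_sum (L : set nat) (n : nat) (s : 'I_n -> nat) :
  numerical_semigroup L -> (forall k, L (s k)) -> L (\sum_(k < n) s k)%N.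
Proof. by move=> [L0 LD _] sL; apply: (big_ind L). Qed.

Lemma subtraction_class_gt0 (L : set nat) (i : nat) :
  subtraction_class i L -> (0 < i)%N.
Proof.
case: i => // -[nsL /(_ (fun=> _))].
have [c Lc] := numerical_semigroup_conductor nsL.
(* A nonzero element is needed, as [c] may be 0; its opposite is negative, hence outside [L]. *)
have Lc1 : L c.+1 by apply: Lc.
move=> /(_ c.+1 (fun=> Lc1) (fun _ _ _ => leqnn _)).
by rewrite pattern_eval_subtraction big_ord0 => -[x _]; lia.
Qed.

Lemma subtraction_class1 : subtraction_class 1 = [set [set: nat]].
Proof.
apply/seteqP; split=> [L [nsL /admits_subtractionSP Lp]|_ ->] /=; last first.
  split; last exact/admits_subtractionSP.
  by split=> //; rewrite setCT.
have [c Lc] := numerical_semigroup_conductor nsL.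
apply/seteqP; split=> // n _.
(* Any [n] is a difference of two elements beyond the bound [c]. *)
pose s (k : 'I_2) := if (k < 1)%N then (c + n)%N else c.
have := Lp s; rewrite big_ord1 /s /= addKn; apply=> [k|j k].
  by case: ifP => _; apply: Lc; rewrite ?leq_addr.
by case: ifP; case: ifP; lia.
Qed.

Lemma subtraction_class2 : subtraction_class 2 = [set L : set nat | Arf L].
Proof.
apply/seteqP; split=> [L [nsL /admits_subtractionSP Lp]|L [nsL Lxyz]] /=.
  split=> // x y z Lx Ly Lz le_yx le_zy.
  (* The default [z] serves as the value at index 2. *)
  pose s (k : 'I_3) := nth z [:: x; y] k.
  have := Lp s; rewrite !big_ord_recr big_ord0 /s /= add0n; apply.
    by case=> -[|[|[]]].
  by case=> -[|[|[|//]]] ? [] [|[|[|//]]] ?; rewrite ?leqnn //= => _;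
    apply: leq_trans le_yx.
split=> //; apply/admits_subtractionSP => s sL sdec.
by rewrite !big_ord_recr big_ord0 /= add0n; apply: Lxyz => //; apply: sdec.
Qed.

Lemma subtraction_class_subS (i : nat) :
  subtraction_class i `<=` subtraction_class i.+1.
Proof.
case: i => [L /subtraction_class_gt0//|i L].
move=> [nsL /admits_subtractionSP Lp]; split=> //.
apply/admits_subtractionSP => s sL sdec.
(* The tail without the largest variable; its value lies in [L], and adding the head back stays in
   [L]. *)
pose t (k : 'I_i.+2) := s (lift ord0 k).
have tdec (j k : 'I_i.+2) : (j <= k)%N -> (t k <= t j)%N.
  by move=> jk; apply: sdec; rewrite !lift0.
have le_t := leq_last_sum tdec.
have Lt := Lp t (fun k => sL _) tdec.
rewrite big_ord_recl (eq_bigr (fun k => t (widen_ord (leqnSn i.+1) k))); last first.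
  by move=> k _; congr s; apply: val_inj.
rewrite (_ : ord_max = lift ord0 ord_max); last exact: val_inj.
rewrite -/(t ord_max) -addnBA; last first.
  by apply: leq_trans le_t; rewrite leq_pmull.
by have [_ LD _] := nsL; apply: LD.
Qed.

Lemma subtraction_class_sub (i j : nat) :
  (i <= j)%N -> subtraction_class i `<=` subtraction_class j.
Proof.
move=> /subnK <-; elim: (j - i)%N => // k IHk.
by apply: subset_trans IHk _; apply: subtraction_class_subS.
Qed.

Lemma subtraction_class_exhaustive (L : set nat) :
  numerical_semigroup L -> exists i, subtraction_class i L.
Proof.
move=> nsL; have [c Lc] := numerical_semigroup_conductor nsL.
exists c.+1; split=> //; apply/admits_subtractionSP => s sL sdec.
(* If the last variable is 0, the value is a plain sum; otherwise it is at least [c * s ord_max],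
   hence at least [c]. *)
have [s0|s_gt0] := posnP (s ord_max).
  by rewrite s0 subn0; apply: numerical_semigroup_sum.
by apply: Lc; have := leq_last_sum sdec; nia.
Qed.

(** For quotient [q] and remainder [r] by [m > 0], one has [n = (q - r) * m + r * (m + 1)] when
    [r <= q]. *)
Definition gen_succ (m : nat) : set nat := [set n | (n %% m <= n %/ m)%N].

Lemma numerical_semigroup_gen_succ (m : nat) :
  (0 < m)%N -> numerical_semigroup (gen_succ m).
Proof.
move=> m_gt0; split=> [|x y|]; rewrite /gen_succ /=.
- by rewrite mod0n.
(* A carry only lowers the remainder and raises the quotient. *)
- move=> xL yL; rewrite -modnDm; apply: leq_trans (leq_mod _ _) _.
  by rewrite divnD //; lia.
(* From [m * m] on, the quotient is at least [m] and exceeds every remainder. *)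
- apply: (@sub_finite_set _ _ `I_(m * m)%N) => [n /= nL|]; last exact: finite_II.
  rewrite ltnNge; apply/negP => le_n; apply: nL.
  by apply: leq_trans (ltnW (ltn_pmod _ m_gt0)) _; rewrite leq_divRL.
Qed.

Lemma gen_succ_notin_subtraction_class (i : nat) :
  ~ subtraction_class i.+1 (gen_succ i.+2).
Proof.
move=> [_ /admits_subtractionSP Lp].
pose s (k : 'I_i.+2) := if (k < i.+1)%N then i.+3 else i.+2.
have /Lp : forall k, gen_succ i.+2 (s k).
  move=> k; rewrite /gen_succ /s /=; case: ifP => _; last by rewrite modnn.
  by rewrite -addn1 modnDl divnDl ?dvdnn // divnn modn_small.
rewrite (eq_bigr (fun=> i.+3)); last by move=> k _; rewrite /s /= ltn_ord.
rewrite sum_nat_const card_ord /s /= ltnn /gen_succ /=.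
(* Quotient [i] and remainder [i.+1]: the membership condition fails by one. *)
rewrite (_ : (_ - _)%N = (i * i.+2 + i.+1)%N); last nia.
rewrite modnMDl divnMDl // modn_small // divn_small // addn0 ltnn.
by move=> sdec; suff: false by []; apply: sdec => j k; rewrite /s; do 2!case: ifP; lia.
Qed.

Theorem mainTheorem4 :
  subtraction_class 0 = set0 /\
  subtraction_class 1 = [set [set: nat]] /\
  subtraction_class 2 = [set L : set nat | Arf L] /\
  (forall i : nat, subtraction_class i `<=` subtraction_class i.+1) /\
  (forall L : set nat, numerical_semigroup L ->
     exists i : nat, subtraction_class i L) /\
  ~ (exists i0 : nat, forall i : nat, (i0 <= i)%N ->
       subtraction_class i = subtraction_class i0).
Proof.
split; first by rewrite -subset0 => L /subtraction_class_gt0.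
split; first exact: subtraction_class1.
split; first exact: subtraction_class2.
split; first exact: subtraction_class_subS.
split; first exact: subtraction_class_exhaustive.
move=> [i0 stab].
have [//|j Lj] := @subtraction_class_exhaustive (gen_succ i0.+2).
  exact: numerical_semigroup_gen_succ.
apply: (@gen_succ_notin_subtraction_class i0).
(* Stability identifies the class of index [i0.+1] with that of index [maxn i0 j], which contains
   the class of index [j]. *)
rewrite (stab i0.+1) // -(stab (maxn i0 j)) ?leq_maxl //.
by apply: subtraction_class_sub Lj; rewrite leq_maxr.
Qed.
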